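(* Every partial Boolean algebra $A$ is, in the category $\mathbf{PBoolean}$, the colimit of the diagram $\mathcal{C}(A)$ of its total subalgebras (ordered by inclusion, with the inclusion maps as transition morphisms), the colimiting cocone being given by the inclusions $i_C\colon C\to A$ for $C\in\mathcal{C}(A)$. The same holds when $\mathcal{C}(A)$ is replaced by the diagram of finitely generated total subalgebras of $A$.
   Context: A partial Boolean algebra is a set $A$ with a reflexive and symmetric relation $\odot\subseteq A\times A$ (commeasurability), elements $0,1\in A$, a total unary operation $\lnot\colon A\to A$, and partial binary operations $\land,\lor\colon\odot\to A$ (defined exactly on commeasurable pairs), such that every set $S\subseteq A$ of pairwise commeasurable elements is contained in a set $T\subseteq A$ whose elements are also pairwise commeasurable and on which $0,1,\lnot,\land,\lor$ determine a Boolean algebra structure (so $T$ contains $0,1$ and is closed under $\lnot,\land,\lor$). A morphism of partial Boolean algebras is a function that preserves commeasurability and all the algebraic structure ($0,1,\lnot,\land,\lor$) whenever defined. The resulting category is $\mathbf{PBoolean}$. A total (or commeasurable) subalgebra of $A$ is a subset of pairwise commeasurable elements containing $0,1$ and closed under $\lnot,\land,\lor$; it is a Boolean algebra. $\mathcal{C}(A)$ is the poset of total subalgebras of $A$ under inclusion. For a set $S\subseteq A$ of pairwise commeasurable elements, $A\langle S\rangle$ is the smallest total subalgebra containing $S$; a total subalgebra is finitely generated if it is of the form $A\langle S\rangle$ with $S$ finite. *)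

(* Defs.v *)
From mathcomp Require Import all_boot.
From mathcomp Require Import boolp classical_sets functions cardinality.

Set Implicit Arguments.
Unset Strict Implicit.
Unset Printing Implicit Defensive.

Local Open Scope classical_set_scope.

(* [zero = one] is not excluded: the one-element algebra is Boolean. *)
Record boolean_laws (X : Type) (zero one : X) (neg : X -> X)
    (meet join : X -> X -> X) : Prop := BooleanLaws {
  bl_meetC : forall x y, meet x y = meet y x;
  bl_joinC : forall x y, join x y = join y x;
  bl_meetA : forall x y z, meet x (meet y z) = meet (meet x y) z;
  bl_joinA : forall x y z, join x (join y z) = join (join x y) z;
  bl_meetKU : forall x y, join x (meet x y) = x;
  bl_joinKI : forall x y, meet x (join x y) = x;
  bl_meetUr : forall x y z, meet x (join y z) = join (meet x y) (meet x z);
  bl_joinIr : forall x y z, join x (meet y z) = meet (join x y) (join x z);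
  bl_meet1 : forall x, meet x one = x;
  bl_join0 : forall x, join x zero = x;
  bl_meetN : forall x, meet x (neg x) = zero;
  bl_joinN : forall x, join x (neg x) = one }.

(* The partial operations take a proof of commeasurability; by proof
   irrelevance they do not depend on which proof is given. *)
Record pba_sig := PBASig {
  carrier :> Type;
  comm : carrier -> carrier -> Prop;
  pzero : carrier;
  pone : carrier;
  pneg : carrier -> carrier;
  pmeet : forall x y, comm x y -> carrier;
  pjoin : forall x y, comm x y -> carrier }.

Arguments comm {_} _ _.
Arguments pzero {_}.
Arguments pone {_}.
Arguments pneg {_} _.
Arguments pmeet {_ x y} _.
Arguments pjoin {_ x y} _.

Notation "x ⊙ y" := (comm x y) (at level 70, no associativity).

Definition pairwise_comm (A : pba_sig) (S : set A) : Prop :=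
  forall x y, S x -> S y -> x ⊙ y.

Record total_subalgebra (A : pba_sig) (C : set A) : Prop := TotalSubalgebra {
  ts_comm : pairwise_comm C;
  ts_zero : C pzero;
  ts_one : C pone;
  ts_neg : forall x, C x -> C (pneg x);
  ts_meet : forall x y (h : x ⊙ y), C x -> C y -> C (pmeet h);
  ts_join : forall x y (h : x ⊙ y), C x -> C y -> C (pjoin h) }.

Section Restriction.
Variables (A : pba_sig) (C : set A) (hC : total_subalgebra C).

Definition sub_zero : {x : A | C x} := exist _ pzero (ts_zero hC).
Definition sub_one : {x : A | C x} := exist _ pone (ts_one hC).
Definition sub_neg (x : {x : A | C x}) : {x : A | C x} :=
  exist _ (pneg (sval x)) (ts_neg hC (proj2_sig x)).
Definition sub_meet (x y : {x : A | C x}) (h : sval x ⊙ sval y) :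
    {x : A | C x} :=
  exist _ (pmeet h) (ts_meet hC h (proj2_sig x) (proj2_sig y)).
Definition sub_join (x y : {x : A | C x}) (h : sval x ⊙ sval y) :
    {x : A | C x} :=
  exist _ (pjoin h) (ts_join hC h (proj2_sig x) (proj2_sig y)).

Definition restriction : pba_sig :=
  @PBASig {x : A | C x} (fun x y => sval x ⊙ sval y)
    sub_zero sub_one sub_neg sub_meet sub_join.

Lemma sub_comm (x y : {x : A | C x}) : sval x ⊙ sval y.
Proof. exact: ts_comm hC _ _ (proj2_sig x) (proj2_sig y). Qed.

Definition is_boolean_subalgebra : Prop :=
  boolean_laws sub_zero sub_one sub_neg
    (fun x y => sub_meet (sub_comm x y)) (fun x y => sub_join (sub_comm x y)).

End Restriction.

Record is_pba (A : pba_sig) : Prop := IsPBA {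
  comm_refl : forall x : A, x ⊙ x;
  comm_sym : forall x y : A, x ⊙ y -> y ⊙ x;
  pba_extension : forall S : set A, pairwise_comm S ->
    exists (T : set A) (hT : total_subalgebra T),
      S `<=` T /\ is_boolean_subalgebra hT }.

Record pba := PBA { pba_sort :> pba_sig; pbaP : is_pba pba_sort }.

Record pba_hom (A B : pba_sig) := PBAHom {
  hom_fun :> A -> B;
  hom_comm : forall x y, x ⊙ y -> hom_fun x ⊙ hom_fun y;
  hom_zero : hom_fun pzero = pzero;
  hom_one : hom_fun pone = pone;
  hom_neg : forall x, hom_fun (pneg x) = pneg (hom_fun x);
  hom_meet : forall x y (h : x ⊙ y),
    hom_fun (pmeet h) = pmeet (hom_comm h);
  hom_join : forall x y (h : x ⊙ y),
    hom_fun (pjoin h) = pjoin (hom_comm h) }.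

Lemma pba_hom_ext (A B : pba_sig) (f g : pba_hom A B) :
  (forall x, f x = g x) -> f = g.
Proof.
case: f g => [f fc f0 f1 fN fM fJ] [g gc g0 g1 gN gM gJ] /= /funext fg.
subst g.
have ? : fc = gc by exact: Prop_irrelevance.
by subst gc; congr PBAHom; exact: Prop_irrelevance.
Qed.

Definition pba_id (A : pba_sig) : pba_hom A A.
Proof. by exists id (fun x y h => h). Defined.

Definition pba_comp (A B C : pba_sig) (g : pba_hom B C) (f : pba_hom A B) :
  pba_hom A C.
Proof.
exists (fun x => g (f x)) (fun x y h => hom_comm g (hom_comm f h)).
- by rewrite !hom_zero.
- by rewrite !hom_one.
- by move=> x; rewrite !hom_neg.
- by move=> x y h; rewrite !hom_meet.
- by move=> x y h; rewrite !hom_join.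
Defined.

Record category := Category {
  ob :> Type;
  hom : ob -> ob -> Type;
  idm : forall X, hom X X;
  comp : forall X Y Z, hom Y Z -> hom X Y -> hom X Z;
  comp_idl : forall X Y (f : hom X Y), comp (idm Y) f = f;
  comp_idr : forall X Y (f : hom X Y), comp f (idm X) = f;
  compA : forall X Y Z W (f : hom X Y) (g : hom Y Z) (h : hom Z W),
    comp h (comp g f) = comp (comp h g) f }.

Arguments hom {_} _ _.
Arguments idm {_} _.
Arguments comp {_ X Y Z} _ _.

Record diagram (J K : category) := Diagram {
  dob :> J -> K;
  dmap : forall i j : J, hom i j -> hom (dob i) (dob j);
  dmap_id : forall i : J, dmap (idm i) = idm (dob i);
  dmap_comp : forall (i j k : J) (v : hom j k) (u : hom i j),
    dmap (comp v u) = comp (dmap v) (dmap u) }.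

Arguments dmap {J K} _ {i j} _.

Record cocone (J K : category) (D : diagram J K) (X : K) := Cocone {
  leg :> forall j : J, hom (D j) X;
  leg_nat : forall (i j : J) (u : hom i j), comp (leg j) (dmap D u) = leg i }.

Definition is_colimit (J K : category) (D : diagram J K) (X : K)
    (c : cocone D X) : Prop :=
  forall (Y : K) (d : cocone D Y),
    exists! m : hom X Y, forall j : J, comp m (c j) = d j.

Definition full_subcategory (J : category) (P : J -> Prop) : category.
Proof.
exists {i : J | P i} (fun i j => hom (sval i) (sval j))
  (fun i => idm (sval i)) (fun i j k v u => comp v u).
- by move=> i j u; exact: comp_idl.
- by move=> i j u; exact: comp_idr.
- by move=> i j k l u v w; exact: compA.
Defined.

Definition restrict_diagram (J K : category) (D : diagram J K)
  (P : J -> Prop) : diagram (full_subcategory P) K.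
Proof.
exists (fun i : full_subcategory P => D (sval i))
  (fun i j u => dmap D (i := sval i) (j := sval j) u).
- by move=> i; exact: dmap_id.
- by move=> i j k v u; exact: dmap_comp.
Defined.

Definition restrict_cocone (J K : category) (D : diagram J K) (X : K)
  (c : cocone D X) (P : J -> Prop) : cocone (restrict_diagram D P) X.
Proof.
exists (fun i : full_subcategory P => c (sval i)).
by move=> i j u; exact: (leg_nat c (i := sval i) (j := sval j) u).
Defined.

Definition PBoolean : category.
Proof.
exists pba pba_hom pba_id (fun A B C g f => pba_comp g f).
- by move=> A B f; exact: pba_hom_ext.
- by move=> A B f; exact: pba_hom_ext.
- by move=> A B C D f g h; exact: pba_hom_ext.
Defined.

Record total_subalg (A : pba_sig) := TotalSubalg {
  tset :> set A;
  tsetP : total_subalgebra tset }.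

Lemma total_subalgebra_boolean (A : pba) (C : set A)
  (hC : total_subalgebra C) : is_boolean_subalgebra hC.
Proof.
have [T [hT [CT bT]]] := pba_extension (pbaP A) (ts_comm hC).
pose i (x : {x : A | C x}) : {x : A | T x} := exist _ (sval x) (CT _ (proj2_sig x)).
have i_inj x y : i x = i y -> x = y.
  by case: x y => [x hx] [y hy] /(congr1 sval) /= xy; apply: eq_exist.
have i0 : i (sub_zero hC) = sub_zero hT by apply: eq_exist.
have i1 : i (sub_one hC) = sub_one hT by apply: eq_exist.
have iN x : i (sub_neg hC x) = sub_neg hT (i x) by apply: eq_exist.
have iM x y : i (sub_meet hC (sub_comm hC x y)) =
    sub_meet hT (sub_comm hT (i x) (i y)).
  by apply: eq_exist => /=; congr pmeet; exact: Prop_irrelevance.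
have iJ x y : i (sub_join hC (sub_comm hC x y)) =
    sub_join hT (sub_comm hT (i x) (i y)).
  by apply: eq_exist => /=; congr pjoin; exact: Prop_irrelevance.
case: bT => bMC bJC bMA bJA bMK bJK bMU bJI bM1 bJ0 bMN bJN.
by split=> *; apply: i_inj; rewrite ?(iM, iJ, iN, i0, i1).
Qed.

Lemma restriction_is_pba (A : pba) (C : set A) (hC : total_subalgebra C) :
  is_pba (restriction hC).
Proof.
split=> [x|x y|S _]; [exact: sub_comm|by move=> _; exact: sub_comm|].
have hT : total_subalgebra (setT : set (restriction hC)).
  by split=> // x y _ _; exact: sub_comm.
exists setT, hT; split=> //.
have [bMC bJC bMA bJA bMK bJK bMU bJI bM1 bJ0 bMN bJN] :=
  total_subalgebra_boolean hC.
pose p (x : {x : restriction hC | setT x}) : {x : A | C x} := sval x.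
have p_inj x y : p x = p y -> x = y.
  by case: x y => [x hx] [y hy] /= xy; apply: eq_exist.
have pM x y : p (sub_meet hT (sub_comm hT x y)) =
    sub_meet hC (sub_comm hC (p x) (p y)).
  by apply: eq_exist => /=; congr pmeet; exact: Prop_irrelevance.
have pJ x y : p (sub_join hT (sub_comm hT x y)) =
    sub_join hC (sub_comm hC (p x) (p y)).
  by apply: eq_exist => /=; congr pjoin; exact: Prop_irrelevance.
have p0 : p (sub_zero hT) = sub_zero hC by [].
have p1 : p (sub_one hT) = sub_one hC by [].
have pN x : p (sub_neg hT x) = sub_neg hC (p x) by [].
by split=> *; apply: p_inj; rewrite ?(pM, pJ, pN, p0, p1).
Qed.

(* Any two elements of [C] are commeasurable, so this is the Boolean algebra [C]
   viewed as a partial Boolean algebra. *)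
Definition subalg (A : pba) (C : total_subalg A) : pba :=
  PBA (restriction_is_pba (tsetP C)).

Definition inclusion (A : pba) (C : total_subalg A) : pba_hom (subalg C) A.
Proof. by exists (fun x : subalg C => sval x) (fun x y h => h). Defined.

Definition subalg_map (A : pba) (C D : total_subalg A)
  (CD : tset C `<=` tset D) : pba_hom (subalg C) (subalg D).
Proof.
exists (fun x : subalg C => exist _ (sval x) (CD _ (proj2_sig x)) : subalg D)
  (fun x y h => h).
all: by move=> *; apply: eq_exist.
Defined.

Definition total_subalgebras (A : pba) : category.
Proof.
exists (total_subalg A) (fun C D => tset C `<=` tset D)
  (fun C => @subset_refl _ (tset C))
  (fun C D E DE CD => subset_trans CD DE).
all: by move=> *; exact: Prop_irrelevance.
Defined.

Definition subalgebra_diagram (A : pba) :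
  diagram (total_subalgebras A) PBoolean.
Proof.
exists (fun C : total_subalgebras A => subalg C : PBoolean)
  (fun C D (CD : tset C `<=` tset D) => subalg_map CD).
- by move=> C; apply: pba_hom_ext => -[x hx]; apply: eq_exist.
- by move=> C D E u v; apply: pba_hom_ext => -[x hx]; apply: eq_exist.
Defined.

Definition inclusion_cocone (A : pba) :
  cocone (subalgebra_diagram A) (A : PBoolean).
Proof.
exists (fun C : total_subalgebras A => inclusion C).
by move=> C D u; exact: pba_hom_ext.
Defined.

Definition generated (A : pba_sig) (S : set A) : set A :=
  smallest (@total_subalgebra A) S.

(* [smallest] is an intersection of sets; for pairwise commeasurable S it is
   itself a total subalgebra. *)
Lemma generated_total_subalgebra (A : pba) (S : set A) :
  pairwise_comm S -> total_subalgebra (generated S).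
Proof.
move=> /(pba_extension (pbaP A)) [T [hT [ST _]]].
split.
- move=> x y /(_ T (conj hT ST)) Tx /(_ T (conj hT ST)) Ty.
  exact: ts_comm hT _ _ Tx Ty.
- by move=> C [hC _]; exact: ts_zero.
- by move=> C [hC _]; exact: ts_one.
- by move=> x Sx C CS; apply: ts_neg (Sx C CS); exact: CS.1.
- by move=> x y h Sx Sy C CS; apply: ts_meet (Sx C CS) (Sy C CS); exact: CS.1.
- by move=> x y h Sx Sy C CS; apply: ts_join (Sx C CS) (Sy C CS); exact: CS.1.
Qed.

Definition finitely_generated (A : pba) (C : total_subalgebras A) : Prop :=
  exists S : set A,
    [/\ finite_set S, pairwise_comm S & tset C = generated S].

(* Main.v *)
(** A cocone [d] determines the mediating map [m] by [m x = d_<x> x], and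
naturality along [<x> `<=` C] gives [m = d_C] on every [C] of the diagram.
Each axiom of a morphism involves at most two commeasurable elements [x, y],
so it can be read off in the finitely generated subalgebra [<x, y>].  A cocone
over all total subalgebras is determined by its finitely generated part, again
because every [x] in [C] lies in [<x> `<=` C]. *)

From mathcomp Require Import all_boot.
From mathcomp Require Import boolp classical_sets.
Require Import Defs.

Set Implicit Arguments.
Unset Strict Implicit.
Unset Printing Implicit Defensive.

Local Open Scope classical_set_scope.

(** The type of [h] mentions [x] and [y], so these cannot be rewritten inside [pmeet h]. Once both
    are substituted, only two proofs of one proposition differ. *)
Lemma pmeet_congr (B : pba_sig) (x x' y y' : B) (h : x ⊙ y) (h' : x' ⊙ y') :
  x = x' -> y = y' -> pmeet h = pmeet h'.
Proof.
by move=> xx' yy'; subst x' y'; congr pmeet; exact: Prop_irrelevance.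
Qed.

Lemma pjoin_congr (B : pba_sig) (x x' y y' : B) (h : x ⊙ y) (h' : x' ⊙ y') :
  x = x' -> y = y' -> pjoin h = pjoin h'.
Proof.
by move=> xx' yy'; subst x' y'; congr pjoin; exact: Prop_irrelevance.
Qed.

Section GeneratedByPair.
Variable A : pba.

Lemma pairwise_comm_pair (x y : A) : x ⊙ y -> pairwise_comm [set x; y].
Proof.
move=> xy _ _ [->|->] [->|->] //; try exact: (comm_refl (pbaP A)).
exact: (comm_sym (pbaP A)).
Qed.

Definition pair_subalg (x y : A) (h : x ⊙ y) : total_subalgebras A :=
  TotalSubalg (generated_total_subalgebra (pairwise_comm_pair h)).

Lemma pair_subalg_fg (x y : A) (h : x ⊙ y) :
  finitely_generated (pair_subalg h).
Proof.
by exists [set x; y]; split=> //; exact: pairwise_comm_pair.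
Qed.

Definition fg_pair_subalg (x y : A) (h : x ⊙ y) :
    full_subcategory (@finitely_generated A) :=
  exist _ (pair_subalg h) (pair_subalg_fg h).

Lemma pair_subalgl (x y : A) (h : x ⊙ y) : tset (pair_subalg h) x.
Proof. by apply: sub_gen_smallest; left. Qed.

Lemma pair_subalgr (x y : A) (h : x ⊙ y) : tset (pair_subalg h) y.
Proof. by apply: sub_gen_smallest; right. Qed.

Lemma pair_subalg_sub (x y : A) (h : x ⊙ y) (C : total_subalgebras A) :
  tset C x -> tset C y -> tset (pair_subalg h) `<=` tset C.
Proof.
by move=> Cx Cy; apply: smallest_sub; [exact: tsetP|move=> _ [->|->]].
Qed.

End GeneratedByPair.

Section FinitelyGenerated.
Variables (A Y : pba).
Variable d : cocone (restrict_diagram (subalgebra_diagram A)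
  (@finitely_generated A)) (Y : PBoolean).

Let leg_hom (C : full_subcategory (@finitely_generated A)) :
  pba_hom (subalg (sval C)) Y := d C.

(** Reflexivity [x ⊙ x] makes the subalgebra generated by [x] the pair case [[set x; x]]. *)
Definition glue (x : A) : Y :=
  let h := comm_refl (pbaP A) x in
  leg_hom (fg_pair_subalg h) (exist _ x (pair_subalgl h)).

(** Lets [glue] be computed in whichever finitely generated subalgebra is convenient. *)
Lemma glueE (C : full_subcategory (@finitely_generated A))
  (x : A) (Cx : tset (sval C) x) : glue x = leg_hom C (exist _ x Cx).
Proof.
have h := pair_subalg_sub (h := comm_refl (pbaP A) x) Cx Cx.
rewrite /glue /leg_hom.
rewrite -(leg_nat d (i := fg_pair_subalg (comm_refl (pbaP A) x)) (j := C) h) /=.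
by congr (hom_fun _ _); exact: eq_exist.
Qed.

Lemma glue_comm (x y : A) : x ⊙ y -> glue x ⊙ glue y.
Proof.
move=> h.
rewrite (glueE (C := fg_pair_subalg h) (pair_subalgl h)).
rewrite (glueE (C := fg_pair_subalg h) (pair_subalgr h)).
exact: hom_comm.
Qed.

Definition glue_hom : pba_hom A Y.
Proof.
exists glue glue_comm.
(* Constants lie in every total subalgebra, so any object of the diagram would serve. *)
- pose C := fg_pair_subalg (comm_refl (pbaP A) pzero).
  rewrite (glueE (C := C) (ts_zero (tsetP (sval C)))).
  exact: (hom_zero (leg_hom C)).
- pose C := fg_pair_subalg (comm_refl (pbaP A) pone).
  rewrite (glueE (C := C) (ts_one (tsetP (sval C)))).
  exact: (hom_one (leg_hom C)).
- pose h x := comm_refl (pbaP A) x.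
  move=> x; rewrite (glueE (C := fg_pair_subalg (h x)) (pair_subalgl (h x))).
  rewrite -hom_neg; exact: glueE.
- move=> x y h.
  pose u : subalg (pair_subalg h) := exist _ x (pair_subalgl h).
  pose v : subalg (pair_subalg h) := exist _ y (pair_subalgr h).
  (* Commeasurability in a subalgebra is that of [A] by conversion, so [pmeet uv] has underlying
     element [pmeet h]. *)
  pose uv : u ⊙ v := h.
  transitivity (leg_hom (fg_pair_subalg h) (pmeet uv)).
    exact: (glueE (C := fg_pair_subalg h) (proj2_sig (pmeet uv))).
  by rewrite hom_meet; apply: pmeet_congr; rewrite -glueE.
- move=> x y h.
  pose u : subalg (pair_subalg h) := exist _ x (pair_subalgl h).
  pose v : subalg (pair_subalg h) := exist _ y (pair_subalgr h).
  pose uv : u ⊙ v := h.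
  transitivity (leg_hom (fg_pair_subalg h) (pjoin uv)).
    exact: (glueE (C := fg_pair_subalg h) (proj2_sig (pjoin uv))).
  by rewrite hom_join; apply: pjoin_congr; rewrite -glueE.
Defined.

End FinitelyGenerated.

Lemma colimit_finitely_generated (A : pba) :
  is_colimit (K := PBoolean)
    (restrict_cocone (inclusion_cocone A) (@finitely_generated A)).
Proof.
move=> Y d; exists (glue_hom d); split.
  by move=> C; apply: pba_hom_ext => -[x Cx]; exact: glueE.
move=> m md; apply: pba_hom_ext => x /=.
(* At [x], the leg at the subalgebra generated by [x] is [m] after the inclusion, which computes to
   [m x]. *)
by rewrite /glue -md.
Qed.

Lemma colimit_total_subalgebras (A : pba) :
  is_colimit (K := PBoolean) (inclusion_cocone A).
Proof.
move=> Y d.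
have [m [md m_uniq]] :=
  colimit_finitely_generated (restrict_cocone d (@finitely_generated A)).
(* Uniqueness is inherited: agreeing with all legs of [d] includes agreeing with the finitely
   generated ones. *)
exists m; split; last by move=> m' m'd; apply: m_uniq => C; exact: m'd.
move=> C; apply: pba_hom_ext => -[x Cx].
pose h := comm_refl (pbaP A) x.
pose u : subalg (pair_subalg h) := exist _ x (pair_subalgl h).
(* [C] need not be finitely generated, so [md] is evaluated at the subalgebra generated by [x] and
   carried to [C] by naturality of [d]. *)
have := congr1 (fun f : pba_hom _ _ => f u) (md (fg_pair_subalg h)).
rewrite /= => ->.
rewrite -(leg_nat d (i := pair_subalg h) (j := C) (pair_subalg_sub Cx Cx)) /=.
by congr (hom_fun _ _); exact: eq_exist.
Qed.

Theorem theorem4 (A : pba) :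
  is_colimit (J := total_subalgebras A) (K := PBoolean)
    (D := subalgebra_diagram A) (X := A) (inclusion_cocone A) /\
  is_colimit (J := full_subcategory (@finitely_generated A)) (K := PBoolean)
    (D := restrict_diagram (subalgebra_diagram A) (@finitely_generated A))
    (X := A) (restrict_cocone (inclusion_cocone A) (@finitely_generated A)).
Proof.
split; first exact: colimit_total_subalgebras.
exact: colimit_finitely_generated.
Qed.
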